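(* $\Gamma\rightarrow\Delta$ has an extended Herbrand-sequent $H$ with $|H|=l$ iff there is a totally rigid acyclic tree grammar $G$ with $|G|=l$ such that $\{F_i\{\bar x\mapsto\bar t\}\mid 1\le i\le p, f_i(\bar t)\in L(G)\}\rightarrow\{F_i\{\bar x\mapsto\bar t\}\mid p<i\le q, f_i(\bar t)\in L(G)\}$ is a tautology.
   Context: Fix $\Gamma\rightarrow\Delta$ of the form $\forall x_1\cdots\forall x_{l_1}F_1,\ldots,\forall x_1\cdots\forall x_{l_p}F_p\rightarrow\exists x_1\cdots\exists x_{l_{p+1}}F_{p+1},\ldots,\exists x_1\cdots\exists x_{l_q}F_q$ with $F_i$ quantifier-free; $F\{\bar x\mapsto\bar t\}$ is simultaneous substitution. An extended Herbrand-sequent is a tautological sequent $\{F_i\{\bar x\mapsto\overline{u_{i,j}}\}\mid i\le p\}, A_1\supset\bigwedge_{j}A_1\{\alpha_1\mapsto s_{1,j}\},\ldots,A_n\supset\bigwedge_j A_n\{\alpha_n\mapsto s_{n,j}\}\rightarrow\{F_i\{\bar x\mapsto\overline{u_{i,j}}\}\mid p<i\le q\}$ with $A_i$ quantifier-free, $\Var(A_i)\subseteq\{\alpha_i,\ldots,\alpha_n\}$, $\Var(s_{i,j})\subseteq\{\alpha_{i+1},\ldots,\alpha_n\}$, of size $\sum_i m_i+\sum_i k_i$. Fresh function symbols $f_1,\ldots,f_q$ with $f_i$ of arity $l_i$ group term tuples. A totally rigid acyclic tree grammar is a regular tree grammar (start symbol $\tau$, productions $\beta\to t$) in which every non-terminal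 is rigid (all its occurrences in a derivation must be replaced by the same term) and no non-terminal derives a term containing itself; $L(G)$ is its set of derivable variable-free terms and $|G|$ its number of productions. In the intended grammars the productions from $\tau$ are of the form $\tau\to f_i(\overline{u_{i,j}})$.
   Formalization: The language is assumed to contain a constant symbol and the sequent Γ→Δ to be closed (the F_i have only the bound variables, parameters being constants); without these, ∀xP(x)→∃xP(x) with no constants, or ∀xP(x)→P(y), refutes the equivalence. *)

(* Defs.v *)
From HB Require Import structures.
From mathcomp Require Import all_boot.
From Stdlib Require Relation_Operators.

Set Implicit Arguments.
Unset Strict Implicit.
Unset Printing Implicit Defensive.

Record alphabet := Alphabet { symbol :> eqType; arity : symbol -> nat }.

(* The recursion is nested in {ffun _}, so the induction principle is given by
   hand below. *)
Unset Elimination Schemes.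
Inductive term (S : alphabet) (V : Type) :=
| Var of V
| App (f : S) of {ffun 'I_(arity f) -> term S V}.
Set Elimination Schemes.
Arguments Var {S V} _.
Arguments App {S V} _ _.

Fixpoint term_ind (S : alphabet) (V : Type) (K : term S V -> Prop)
    (hV : forall x, K (Var x))
    (hA : forall f (a : {ffun 'I_(arity f) -> term S V}),
        (forall i, K (a i)) -> K (App f a))
    (t : term S V) : K t :=
  match t with
  | Var x => hV x
  | App f a => hA f a (fun i => term_ind hV hA (a i))
  end.

Section TermEq.
Variables (S : alphabet) (V : eqType).

Fixpoint term_encode (t : term S V) : GenTree.tree (V + S) :=
  match t with
  | Var x => GenTree.Leaf (inl x)
  | App f a => GenTree.Node 0 (GenTree.Leaf (inr f) ::
                 [seq term_encode (a i) | i <- enum 'I_(arity f)])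
  end.

Lemma term_encode_inj : injective term_encode.
Proof.
elim=> [x|f a IH] [y|g b] //= => [[->] //|[efg]].
case: g / efg b => b /eq_in_map eab; congr App.
by apply/ffunP=> i; apply/IH/eab; rewrite mem_enum.
Qed.

HB.instance Definition _ :=
  hasDecEq.Build (term S V) (inj_eqAxiom term_encode_inj).

Fixpoint occurs (x : V) (t : term S V) : bool :=
  match t with
  | Var y => x == y
  | App f a => [exists i, occurs x (a i)]
  end.
End TermEq.

Fixpoint subst (S : alphabet) (V W : Type) (sigma : V -> term S W)
    (t : term S V) : term S W :=
  match t with
  | Var x => sigma x
  | App f a => App f [ffun i => subst sigma (a i)]
  end.

(* Positions are words of 0-based argument indices. *)
Fixpoint subterm_at (S : alphabet) (V : Type) (t : term S V) (w : seq nat) :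
    option (term S V) :=
  match w, t with
  | [::], _ => Some t
  | _ :: _, Var _ => None
  | i :: w', App f a =>
      if (insub i : option 'I_(arity f)) is Some j then subterm_at (a j) w'
      else None
  end.

Inductive formula (S P : alphabet) (V : Type) :=
| Atom (R : P) of {ffun 'I_(arity R) -> term S V}
| Top
| Bot
| Neg of formula S P V
| And of formula S P V & formula S P V
| Or of formula S P V & formula S P V
| Imp of formula S P V & formula S P V.
Arguments Top {S P V}.
Arguments Bot {S P V}.

Fixpoint map_terms (S S' P : alphabet) (V W : Type)
    (h : term S V -> term S' W) (A : formula S P V) : formula S' P W :=
  match A with
  | Atom R a => Atom [ffun i => h (a i)]
  | Top => Top
  | Bot => Bot
  | Neg B => Neg (map_terms h B)
  | And B C => And (map_terms h B) (map_terms h C)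
  | Or B C => Or (map_terms h B) (map_terms h C)
  | Imp B C => Imp (map_terms h B) (map_terms h C)
  end.

Definition fsubst (S P : alphabet) (V W : Type) (sigma : V -> term S W) :
    formula S P V -> formula S P W :=
  map_terms (subst sigma).

Fixpoint foccurs (S P : alphabet) (V : eqType) (x : V) (A : formula S P V) :
    bool :=
  match A with
  | Atom R a => [exists i, occurs x (a i)]
  | Top | Bot => false
  | Neg B => foccurs x B
  | And B C | Or B C | Imp B C => foccurs x B || foccurs x C
  end.

(* Truth is propositional: atoms, with or without variables, are independent
   propositional letters. *)
Definition valuation (S P : alphabet) (V : Type) :=
  forall R : P, {ffun 'I_(arity R) -> term S V} -> bool.

Fixpoint eval (S P : alphabet) (V : Type) (v : valuation S P V)
    (A : formula S P V) : bool :=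
  match A with
  | Atom R a => v R a
  | Top => true
  | Bot => false
  | Neg B => ~~ eval v B
  | And B C => eval v B && eval v C
  | Or B C => eval v B || eval v C
  | Imp B C => eval v B ==> eval v C
  end.

Definition tautology (S P : alphabet) (V : Type)
    (ante succ : formula S P V -> Prop) : Prop :=
  forall v : valuation S P V,
    (forall A, ante A -> eval v A) -> exists2 B, succ B & eval v B.

(* The sequent
     forall x_1 .. x_(l_1) F_1, .., forall x_1 .. x_(l_p) F_p ->
       exists x_1 .. x_(l_(p+1)) F_(p+1), .., exists x_1 .. x_(l_q) F_q,
   indexed from 0. It is closed: the only variables of F_i are the l_i bound
   ones, represented by 'I_(l_i). *)
Record prenex_sequent (S P : alphabet) := PrenexSequent {
  nb_ante : nat;
  nb_form : nat;
  nb_ante_le : nb_ante <= nb_form;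
  nb_vars : 'I_nb_form -> nat;
  matrix_of : forall i : 'I_nb_form, formula S P 'I_(nb_vars i)
}.
Arguments matrix_of {S P} _ _.
Arguments nb_vars {S P} _ _.

Section ExtendedHerbrand.
Variables (S P : alphabet) (E : prenex_sequent S P).

(* Object variables are natural numbers; the m_i and k_i may be 0. *)
Record herbrand_data := HerbrandData {
  m_of : 'I_(nb_form E) -> nat;
  u_of : forall i, 'I_(m_of i) -> 'I_(nb_vars E i) -> term S nat;
  n_of : nat;
  alpha : 'I_n_of -> nat;
  cutf : 'I_n_of -> formula S P nat;
  k_of : 'I_n_of -> nat;
  s_of : forall i, 'I_(k_of i) -> term S nat
}.

Variable H : herbrand_data.

Definition herbrand_size : nat :=
  \sum_(i < nb_form E) m_of H i + \sum_(i < n_of H) k_of i.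

Definition single_subst (x : nat) (s : term S nat) (y : nat) : term S nat :=
  if y == x then s else Var y.

(* The conjunction is right-nested and ends in Top. *)
Definition cut_implication (i : 'I_(n_of H)) : formula S P nat :=
  Imp (cutf i)
      (\big[@And S P nat/Top]_(j < k_of i)
          fsubst (single_subst (alpha i) (s_of j)) (cutf i)).

Definition herbrand_ante (A : formula S P nat) : Prop :=
  (exists (i : 'I_(nb_form E)) (j : 'I_(m_of H i)),
      i < nb_ante E /\ A = fsubst (u_of j) (matrix_of E i))
  \/ exists i, A = cut_implication i.

Definition herbrand_succ (A : formula S P nat) : Prop :=
  exists (i : 'I_(nb_form E)) (j : 'I_(m_of H i)),
    nb_ante E <= i /\ A = fsubst (u_of j) (matrix_of E i).

Definition extended_herbrand : Prop :=
  [/\ injective (@alpha H),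
      forall (i : 'I_(n_of H)) x, foccurs x (cutf i) ->
        exists2 j : 'I_(n_of H), i <= j & x = alpha j,
      forall (i : 'I_(n_of H)) (j : 'I_(k_of i)) x, occurs x (s_of j) ->
        exists2 j' : 'I_(n_of H), i < j' & x = alpha j'
    & tautology herbrand_ante herbrand_succ].
End ExtendedHerbrand.

(* Non-terminals are nullary symbols disjoint from the alphabet, so the terms
   over both are the terms with variables in the set of non-terminals. *)
Record tree_grammar (S : alphabet) := TreeGrammar {
  nonterm : finType;
  start : nonterm;
  prods : seq (nonterm * term S nonterm);
  prods_uniq : uniq prods
}.
Arguments nonterm {S} _.
Arguments start {S} _.
Arguments prods {S} _.

Section Language.
Variables (S : alphabet) (G : tree_grammar S).

Inductive step : term S (nonterm G) -> term S (nonterm G) -> Prop :=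
| step_root b t : (b, t) \in prods G -> step (Var b) t
| step_arg f (a a' : {ffun 'I_(arity f) -> term S (nonterm G)}) i :
    step (a i) (a' i) -> (forall j, j != i -> a' j = a j) ->
    step (App f a) (App f a').

Definition acyclic : Prop :=
  forall (b : nonterm G) (t : term S (nonterm G)),
    Relation_Operators.clos_trans _ step (Var b) t -> ~~ occurs b t.

(* d 0, .., d n is a derivation of d n from the start symbol. *)
Definition derivation (n : nat) (d : nat -> term S (nonterm G)) : Prop :=
  d 0 = Var (start G) /\ forall i, i < n -> step (d i) (d i.+1).

(* Any two positions at which b occurs in the course of the derivation carry
   the same subterm of the final term; this is required of all non-terminals. *)
Definition totally_rigid (n : nat) (d : nat -> term S (nonterm G)) : Prop :=
  forall (b : nonterm G) i j w w', i <= n -> j <= n ->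
    subterm_at (d i) w = Some (Var b) -> subterm_at (d j) w' = Some (Var b) ->
    subterm_at (d n) w = subterm_at (d n) w'.

(* Variable-free terms are the terms with variables in void. *)
Definition language (t : term S void) : Prop :=
  exists n d, [/\ derivation n d, totally_rigid n d
                & d n = subst (fun x : void => Var (of_void _ x)) t].
End Language.

Section HerbrandGrammar.
Variables (S P : alphabet) (E : prenex_sequent S P).

(* S together with the fresh symbols f_i, which are the inr i. *)
Definition ext_arity (g : S + 'I_(nb_form E)) : nat :=
  match g with inl f => arity f | inr i => nb_vars E i end.

Definition ext_alphabet : alphabet := Alphabet ext_arity.

Definition tuple_sym (i : 'I_(nb_form E)) : ext_alphabet := inr i.

Fixpoint embed (V : Type) (t : term S V) : term ext_alphabet V :=
  match t with
  | Var x => Var x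
  | App f a => @App ext_alphabet V (inl f) [ffun i => embed (a i)]
  end.

Definition tuple_term (V : Type) (i : 'I_(nb_form E))
    (t : {ffun 'I_(nb_vars E i) -> term ext_alphabet V}) :
    term ext_alphabet V :=
  App (tuple_sym i) t.

Definition inst (V : Type) (i : 'I_(nb_form E))
    (t : {ffun 'I_(nb_vars E i) -> term ext_alphabet V}) :
    formula ext_alphabet P V :=
  fsubst t (map_terms (@embed _) (matrix_of E i)).

Variable G : tree_grammar ext_alphabet.

(* Productions from the other non-terminals are unrestricted; in particular
   the arguments u and t below may contain symbols f_i, whence inst works over
   the extended alphabet. *)
Definition start_tuples : Prop :=
  forall r, (start G, r) \in prods G ->
    exists i (u : {ffun 'I_(nb_vars E i) -> term ext_alphabet (nonterm G)}),
      r = tuple_term u.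

Definition language_ante (A : formula ext_alphabet P void) : Prop :=
  exists i (t : {ffun 'I_(nb_vars E i) -> term ext_alphabet void}),
    [/\ i < nb_ante E, language G (tuple_term t) & A = inst t].

Definition language_succ (A : formula ext_alphabet P void) : Prop :=
  exists i (t : {ffun 'I_(nb_vars E i) -> term ext_alphabet void}),
    [/\ nb_ante E <= i, language G (tuple_term t) & A = inst t].
End HerbrandGrammar.

(* Main.v *)
(* The language of a totally rigid acyclic grammar consists of the values of the
   start symbol under the ground substitutions sigma such that every relevant
   non-terminal b has a production b -> r with sigma b = r sigma. The non-terminals
   other than the start symbol play the role of the alpha_i.

   From a Herbrand-sequent to a grammar: given a valuation, sigma is chosen on
   alpha_n, .., alpha_1 in turn, sending alpha_i to some s_(i,j) sigma that
   falsifies A_i if there is one. All cut implications are then true under sigma,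
   and the remaining formulas of the sequent become instances from the language.

   From a grammar to a Herbrand-sequent: sort the non-terminals topologically,
   let A_1 be the conjunction of the instances to be refuted and
   A_(i+1) = /\_j A_i{alpha_i |-> s_(i,j)}. A valuation falsifying the sequent makes
   all A_i true, and the last one implies A_1 sigma for each sigma as above, so the
   valuation falsifies the sequent of the language as well. *)
Require Import Defs.
From HB Require Import structures.
From mathcomp Require Import all_boot.
From Stdlib Require Import Classical Relation_Operators Operators_Properties.

Set Implicit Arguments.
Unset Strict Implicit.
Unset Printing Implicit Defensive.

(** * Substitution in terms *)

Section Terms.
Variable S : alphabet.

Lemma subst_comp (V W X : Type) (sigma : V -> term S W) (theta : W -> term S X)
    (t : term S V) :
  subst theta (subst sigma t) = subst (fun x => subst theta (sigma x)) t.
Proof. by elim: t => //= f a IH; congr App; apply/ffunP=> i; rewrite !ffunE. Qed.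

Lemma eq_in_subst (V : eqType) (W : Type) (sigma theta : V -> term S W) t :
  (forall x, occurs x t -> sigma x = theta x) -> subst sigma t = subst theta t.
Proof.
elim: t => [x|f a IH] eqst /=; first by rewrite eqst /=.
congr App; apply/ffunP=> i; rewrite !ffunE; apply: IH => x ox.
by apply: eqst; apply/existsP; exists i.
Qed.

Lemma subst_id (V : eqType) (sigma : V -> term S V) t :
  (forall x, occurs x t -> sigma x = Var x) -> subst sigma t = t.
Proof.
elim: t => [x|f a IH] eqst /=; first by rewrite eqst /=.
congr App; apply/ffunP=> i; rewrite !ffunE; apply: IH => x ox.
by apply: eqst; apply/existsP; exists i.
Qed.

Lemma occurs_App (V : eqType) (x : V) f (a : {ffun 'I_(arity f) -> term S V}) :
  occurs x (App f a) -> exists i, occurs x (a i).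
Proof. by case/existsP=> i ox; exists i. Qed.

Lemma occurs_subst (V W : eqType) (sigma : V -> term S W) t x :
  occurs x (subst sigma t) -> exists2 y, occurs y t & occurs x (sigma y).
Proof.
elim: t => [y|f a IH] /=; first by exists y.
case/existsP=> i; rewrite ffunE => /IH[y oy ox].
by exists y => //; apply/existsP; exists i.
Qed.

Lemma subterm_at_nil (V : Type) (t : term S V) : subterm_at t [::] = Some t.
Proof. by case: t. Qed.

Lemma subterm_at_subst (V W : Type) (sigma : V -> term S W) t w s :
  subterm_at t w = Some s -> subterm_at (subst sigma t) w = Some (subst sigma s).
Proof.
elim: w t => [|k w IH] t; first by rewrite !subterm_at_nil => -[<-].
case: t => //= f a; case: insub => // j /IH.
by rewrite ffunE.
Qed.

Variables (c : S) (hc : arity c = 0).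

(** A ground filler for variables without a production and for tuple symbols inside terms. *)
Definition const_term (V : Type) : term S V :=
  App c (ffun0 (etrans (card_ord (arity c)) hc)).

Lemma subst_const (V W : Type) (sigma : V -> term S W) :
  subst sigma (const_term V) = const_term W.
Proof.
by congr App; apply/ffunP=> -[k ltk]; exfalso; move: ltk; rewrite hc.
Qed.

Lemma occurs_const (V : eqType) (x : V) : occurs x (const_term V) = false.
Proof. by apply/existsP=> -[[k ltk]]; exfalso; move: ltk; rewrite hc. Qed.
End Terms.

(** * Evaluation of formulas under substitutions *)

Section Formulas.
Variables S P : alphabet.

(** Evaluating a substituted formula amounts to evaluating the original one under a transported
    valuation, so semantic arguments can stay on the side of valuations. *)
Definition pull (S' : alphabet) (V W : Type) (h : term S V -> term S' W)
    (v : valuation S' P W) : valuation S P V :=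
  fun R a => v R [ffun i => h (a i)].

Lemma eval_map_terms (S' : alphabet) (V W : Type) (h : term S V -> term S' W) v
    (A : formula S P V) :
  eval v (map_terms h A) = eval (pull h v) A.
Proof. by elim: A => //= [B ->|B -> C ->|B -> C ->|B -> C ->]. Qed.

Lemma eq_in_eval (S' : alphabet) (V : eqType) (W : Type)
    (h h' : term S V -> term S' W) v (A : formula S P V) :
  (forall t, (forall x, occurs x t -> foccurs x A) -> h t = h' t) ->
  eval (pull h v) A = eval (pull h' v) A.
Proof.
elim: A => //= [R a|B IH|B IHB C IHC|B IHB C IHC|B IHB C IHC] eqh.
- congr v; apply/ffunP=> i; rewrite !ffunE; apply: eqh => x ox.
  by apply/existsP; exists i.
- by rewrite IH.
- by rewrite IHB ?IHC // => t st; apply: eqh => x /st ->; rewrite ?orbT.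
- by rewrite IHB ?IHC // => t st; apply: eqh => x /st ->; rewrite ?orbT.
- by rewrite IHB ?IHC // => t st; apply: eqh => x /st ->; rewrite ?orbT.
Qed.

Lemma eq_eval (V : Type) (v v' : valuation S P V) A :
  (forall R a, v R a = v' R a) -> eval v A = eval v' A.
Proof. by move=> eqv; elim: A => //= [B ->|B -> C ->|B -> C ->|B -> C ->]. Qed.

Lemma foccurs_fsubst (V W : eqType) (sigma : V -> term S W) (A : formula S P V) x :
  foccurs x (fsubst sigma A) -> exists2 y, foccurs y A & occurs x (sigma y).
Proof.
elim: A => //= [R a|B IHB C IHC|B IHB C IHC|B IHB C IHC].
- case/existsP=> i; rewrite ffunE => /occurs_subst[y oy ox].
  by exists y => //; apply/existsP; exists i.
- by case/orP=> [/IHB|/IHC] [y oy ox]; exists y; rewrite ?oy ?orbT.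
- by case/orP=> [/IHB|/IHC] [y oy ox]; exists y; rewrite ?oy ?orbT.
- by case/orP=> [/IHB|/IHC] [y oy ox]; exists y; rewrite ?oy ?orbT.
Qed.

Lemma eval_bigAnd (V : Type) (v : valuation S P V) (I : finType)
    (A : I -> formula S P V) :
  eval v (\big[@And S P V/Top]_i A i) = [forall i, eval v (A i)].
Proof. by rewrite (big_morph (eval v) (op1 := andb) (id1 := true)) // big_andE. Qed.

Lemma foccurs_bigAnd (V : eqType) (x : V) (I : finType) (A : I -> formula S P V) :
  foccurs x (\big[@And S P V/Top]_i A i) = [exists i, foccurs x (A i)].
Proof. by rewrite (big_morph (foccurs x) (op1 := orb) (id1 := false)) // big_orE. Qed.
End Formulas.

(** Values are chosen from the largest index down, since [R i] sees only the values at indices above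
    [i]. Both directions of the theorem solve a triangular system this way. *)
Lemma backward_choice (T : Type) (x0 : T) (n : nat)
    (R : 'I_n -> ('I_n -> T) -> T -> Prop) :
  (forall (i : 'I_n) f g x, (forall j : 'I_n, i < j -> f j = g j) -> R i f x -> R i g x) ->
  (forall i f, exists x, R i f x) ->
  exists f, forall i, R i f (f i).
Proof.
move=> locR exR.
suff /(_ n (leqnn n)) [f Rf] : forall m, m <= n ->
    exists f, forall i : 'I_n, n - m <= i -> R i f (f i).
  by exists f => i; apply: Rf; rewrite subnn.
elim=> [|m IH] ltmn.
  by exists (fun _ => x0) => i; rewrite subn0 leqNgt ltn_ord.
have [f Rf] := IH (ltnW ltmn).
have lti : n - m.+1 < n by rewrite -subn_gt0 subKn.
pose i0 := Ordinal lti; have [x Rx] := exR i0 f.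
pose g j := if j == i0 then x else f j.
have fg (j : 'I_n) : i0 < j -> f j = g j.
  by rewrite /g; case: eqP => // ->; rewrite ltnn.
exists g => i; rewrite leq_eqVlt => /orP[/eqP ei|lei].
  have ->: i = i0 by apply: val_inj.
  by rewrite {2}/g eqxx; apply: locR Rx.
rewrite -fg //; apply: (locR _ f) => [j ltij|]; first by apply/fg/(ltn_trans lei).
by apply: Rf; rewrite -subSn // subSS in lei.
Qed.

(** * Acyclic grammars: dependency order and description of the language by substitutions *)

Section Grammar.
Variables (S : alphabet) (G : tree_grammar S).
Notation N := (nonterm G).

Definition depends : rel N :=
  [rel b b' | has (fun p => (p.1 == b) && occurs b' p.2) (prods G)].

Lemma dependsP b b' :
  reflect (exists2 r, (b, r) \in prods G & occurs b' r) (depends b b').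
Proof.
apply: (iffP hasP) => [[[b1 r] pr /= /andP[/eqP <- ob]]|[r pr ob]]; first by exists r.
by exists (b, r); rewrite //= eqxx.
Qed.

(** The rewritten position is made explicit because rigidity is a condition on positions. The last
    clause makes the value under a solution of the production an invariant of the step. *)
Lemma step_position (t t' : term S N) : step t t' ->
  exists w b r, [/\ (b, r) \in prods G, subterm_at t w = Some (Var b),
    subterm_at t' w = Some r,
    (forall x, occurs x r -> occurs x t') /\
    (forall x, occurs x t -> x = b \/ occurs x t')
    & forall U (sigma : N -> term S U),
        sigma b = subst sigma r -> subst sigma t = subst sigma t'].
Proof.
elim=> {t t'} [b t pr|f a a' i _ [w [b [r [pr tw t'w [rt' tt'] eqst]]]] eqa].
  exists [::], b, t; rewrite !subterm_at_nil.
  by split=> //; split=> // x /eqP; left.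
exists (val i :: w), b, r; split=> //=; rewrite ?valK //.
  split=> [x /rt' ox|x /existsP[j]]; first by apply/existsP; exists i.
  have [-> /tt' [|ox]|neji ox] := eqVneq j i; first by left.
    by right; apply/existsP; exists i.
  by right; apply/existsP; exists j; rewrite eqa.
move=> U sigma /eqst ei; congr App; apply/ffunP=> j; rewrite !ffunE.
by have [->|/eqa ->] := eqVneq j i.
Qed.

Lemma step_occurs (b : N) r t : (b, r) \in prods G -> occurs b t ->
  exists2 t', step t t' & forall x, occurs x r -> occurs x t'.
Proof.
move=> pr; elim: t => [y /eqP <-|f a IH /existsP[i /IH[t' st rt']]].
  by exists r => //; apply: step_root.
pose a' := [ffun j => if j == i then t' else a j].
exists (App f a').
  by apply: (@step_arg _ _ _ _ _ i); rewrite ?ffunE ?eqxx // => j /negPf nj; rewrite ffunE nj.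
by move=> x /rt' ox; apply/existsP; exists i; rewrite ffunE eqxx.
Qed.

Lemma path_depends_reach b b' p : path depends b (rcons p b') ->
  exists2 t, clos_trans _ (@step S G) (Var b) t & occurs b' t.
Proof.
elim/last_ind: p b' => [|p b1 IH] b'; rewrite rcons_path.
  move=> /= /dependsP[r pr ob].
  by exists r => //; apply/t_step/step_root.
rewrite last_rcons => /andP[/IH[t bt ot] /dependsP[r pr ob]].
have [t' st rt'] := step_occurs pr ot.
by exists t'; [apply: t_trans bt (t_step _ _ _ _ st)|apply: rt'].
Qed.

Definition rank (b : N) : nat := #|[set b' | connect depends b b']|.

(** Whatever [b'] reaches, [b] reaches too. But [b] reaches itself, whereas [b'] cannot reach [b]: a
    cycle through [b] would derive from it a term containing [b]. *)
Lemma rank_lt b b' : acyclic G -> depends b b' -> rank b' < rank b.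
Proof.
move=> acG dbb'; apply/proper_card/properP; split.
  apply/subsetP=> x; rewrite !inE; apply: connect_trans; exact: connect1.
exists b; rewrite !inE ?connect0 //; apply/negP=> /connectP[p pb eb].
have : path depends b (b' :: p) by rewrite /= dbb'.
rewrite lastI -eb => /path_depends_reach[t bt].
exact/negP/acG.
Qed.

(** A step replaces a non-terminal by ones of smaller [h], so strict upper bounds persist; the first
    step out of [Var b] establishes the bound [h b]. *)
Lemma acyclic_of_rank (h : N -> nat) :
  (forall b r x, (b, r) \in prods G -> occurs x r -> h x < h b) -> acyclic G.
Proof.
move=> hlt b t /clos_trans_t1n_iff bt.
suff lt_t: forall x, occurs x t -> h x < h b by apply/negP=> ob; move: (lt_t _ ob); rewrite ltnn.
have stepP (M : nat) t1 t2 : step t1 t2 ->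
    (forall x, occurs x t1 -> h x < M) -> forall x, occurs x t2 -> h x < M.
  elim=> [b1 r pr /= bM x /(hlt _ _ _ pr) ltx|f a a' i _ IH eqa aM x /existsP[j]].
    by apply: ltn_trans ltx _; apply: bM; apply: eqxx.
  have [->|neji] := eqVneq j i => [|oj].
    by apply: IH => y oy; apply: aM; apply/existsP; exists i.
  by apply: aM; apply/existsP; exists j; rewrite -eqa.
have trP t1 t2 : clos_trans_1n _ (@step S G) t1 t2 ->
    (forall x, occurs x t1 -> h x < h b) -> forall x, occurs x t2 -> h x < h b.
  by elim=> [u1 u2 /stepP|u1 u2 u3 /stepP st _ IH /st /IH] //; apply.
have root t1 : step (Var b) t1 -> forall x, occurs x t1 -> h x < h b.
  by move=> st; inversion st; subst => x; apply: hlt.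
by case: bt => [t1 /root //|t1 t2 /root lt1 /trP]; apply.
Qed.

(** Rigidity makes [sigma b] well defined as the subterm of [t] at any position where [b] occurs
    during the derivation. [D] collects the non-terminals occurring from the second term on; [t0] is
    the value of those that never occur. *)
Lemma language_substitution (t0 t : term S void) :
  acyclic G -> language G t ->
  exists sigma : N -> term S void, exists D : N -> Prop,
    (exists2 r, (start G, r) \in prods G /\ t = subst sigma r
              & forall b, occurs b r -> D b) /\
    forall b, D b -> b != start G /\
      exists2 r, (b, r) \in prods G /\ sigma b = subst sigma r
               & forall b', occurs b' r -> D b'.
Proof.
move=> acG [n [d [[d0 dstep] rigid dn]]].
have nocc x : ~~ occurs x (d n).
  by rewrite dn; elim: (t) => [[]|f a IH] /=; apply/existsPn=> i; rewrite ffunE.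
have tE (f : N -> term S void) : t = subst f (d n).
  by rewrite dn subst_comp subst_id // => -[].
have t_at (f : N -> term S void) w u :
    subterm_at (d n) w = Some u -> subterm_at t w = Some (subst f u).
  by rewrite (tE f); apply: subterm_at_subst.
have [sigma sigmaP] : exists sigma : N -> term S void, forall b i w, i <= n ->
    subterm_at (d i) w = Some (Var b) -> odflt t0 (subterm_at t w) = sigma b.
  apply: (fin_all_exists (P := fun b u => forall i w, i <= n ->
    subterm_at (d i) w = Some (Var b) -> odflt t0 (subterm_at t w) = u)) => b.
  have [[i0 [w0 [lei0 dw0]]]|nob] :=
    classic (exists i w, i <= n /\ subterm_at (d i) w = Some (Var b)).
    exists (odflt t0 (subterm_at t w0)) => i w lei dw.
    have := rigid b i i0 w w0 lei lei0 dw dw0.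
    case eqw: (subterm_at (d n) w) => [u|] /esym eqw0.
      by rewrite (t_at (fun=> t0) _ _ eqw) (t_at (fun=> t0) _ _ eqw0).
    have noneP w' : subterm_at (d n) w' = None -> subterm_at t w' = None.
      rewrite dn; elim: w' (t) => [|k w' IH] [[]|f a] //=.
      by case: insub => // j; rewrite ffunE; apply: IH.
    by rewrite !noneP.
  by exists t0 => i w lei dw; case: nob; exists i, w.
(* Induction backwards from the end of the derivation. The later index [i'] shows that the
   non-terminals of [r] occur in the derivation too, so that [D] is closed under the productions
   found. *)
have main m i : i + m = n -> subst sigma (d i) = t /\
    forall b, occurs b (d i) -> exists2 r, (b, r) \in prods G /\ sigma b = subst sigma r
      & exists2 i', i < i' <= n & forall b', occurs b' r -> occurs b' (d i').
  elim: m i => [|m IH] i; rewrite ?addn0 ?addnS => ein.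
    rewrite ein -tE; split=> // b ob; by rewrite (negPf (nocc b)) in ob.
  have [teq occP] := IH i.+1 ein.
  have lti : i < n by rewrite -ein ltnS leq_addr.
  have [w [b [r [pr dw dw' [rd bd] eqst]]]] := step_position (dstep i lti).
  have sb : sigma b = subst sigma r.
    rewrite -(sigmaP b i w (ltnW lti) dw).
    by move/(subterm_at_subst sigma): dw'; rewrite teq => ->.
  split=> [|x /bd[->|/occP[r' eqr [i' /andP[lti' lei'] occi']]]].
  - by rewrite (eqst _ sigma sb).
  - by exists r => //; exists i.+1; rewrite ?leqnn.
  by exists r' => //; exists i'; rewrite ?(ltnW lti').
have n_gt0 : 0 < n.
  rewrite lt0n; apply/eqP=> n0; move: (nocc (start G)).
  by rewrite n0 d0 /= eqxx.
exists sigma, (fun b => exists2 i, 0 < i <= n & occurs b (d i)); split.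
  have [[teq _] [t1 _]] := (main n 0 (add0n n), main n.-1 1 (ltn_predK n_gt0)).
  exists (d 1) => [|b ob]; last by exists 1.
  by split=> //; have := dstep 0 n_gt0; rewrite d0 => st; inversion st.
move=> b [i /andP[i_gt0 lei] ob]; split.
  apply: contraL ob => /eqP ->; apply: acG; rewrite -d0.
  elim: i i_gt0 lei => // -[|i] IH _ lei; first exact/t_step/dstep.
  by apply: t_trans (IH isT (ltnW lei)) _; apply/t_step/dstep.
have [_ /(_ b ob)[r eqr [i' /andP[lti' lei'] occi']]] := main (n - i) i (subnKC lei).
exists r => // b' /occi' ob'; exists i' => //.
by rewrite lei' (leq_trans i_gt0 (ltnW lti')).
Qed.

(** All terms of such a derivation have the same value under [sigma]; this invariant later yields
    rigidity. *)
Definition steps (U : Type) (sigma : N -> term S U) :=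
  clos_refl_trans_1n _ (fun t t' : term S N => step t t' /\ subst sigma t = subst sigma t').

Lemma steps_trans (U : Type) (sigma : N -> term S U) t1 t2 t3 :
  steps sigma t1 t2 -> steps sigma t2 t3 -> steps sigma t1 t3.
Proof.
by elim=> // u1 u2 u3 s12 _ IH /IH; apply: Relation_Operators.rt1n_trans.
Qed.

Lemma steps_arg (U : Type) (sigma : N -> term S U) f i t t'
    (a : {ffun 'I_(arity f) -> term S N}) :
  steps sigma t t' -> steps sigma (App f [ffun j => if j == i then t else a j])
                                  (App f [ffun j => if j == i then t' else a j]).
Proof.
elim=> [u|u1 u2 u3 [st eqst] _ IH]; first exact: rt1n_refl.
apply: Relation_Operators.rt1n_trans IH; split.
  apply: (@step_arg _ _ _ _ _ i) => [|j /negPf nj]; rewrite !ffunE ?eqxx //.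
  by rewrite nj.
by congr App; apply/ffunP=> j; rewrite !ffunE; case: eqP.
Qed.

Lemma steps_App (U : Type) (sigma : N -> term S U) f
    (a a' : {ffun 'I_(arity f) -> term S N}) :
  (forall i, steps sigma (a i) (a' i)) -> steps sigma (App f a) (App f a').
Proof.
(* Arguments are rewritten one at a time; [mix s] is the state once those in [s] are done. *)
move=> aa'; pose mix (s : seq 'I_(arity f)) := [ffun i => if i \in s then a' i else a i].
suff: steps sigma (App f a) (App f (mix (enum 'I_(arity f)))).
  by congr (steps _ _ (App f _)); apply/ffunP=> i; rewrite ffunE mem_enum.
elim: (enum _) => [|i s IH].
  rewrite (_ : mix _ = a); first exact: rt1n_refl.
  by apply/ffunP=> i; rewrite ffunE.
apply: steps_trans IH _; have [si|nsi] := boolP (i \in s).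
  rewrite (_ : mix (i :: s) = mix s); first exact: rt1n_refl.
  by apply/ffunP=> j; rewrite !ffunE inE; case: eqP => // ->; rewrite si.
have := steps_arg i (mix s) (aa' i); congr (steps _ (App f _) (App f _)).
  by apply/ffunP=> j; rewrite !ffunE; case: eqP => // ->; rewrite (negPf nsi).
by apply/ffunP=> j; rewrite !ffunE inE; case: eqP => // ->.
Qed.

(** Expanding each [b] by the production that [sigma] solves terminates because [h] decreases.
    Rigidity is then automatic: the final subterm at a position where [b] occurred is always
    [sigma b]. *)
Lemma substitution_language (h : N -> nat) (sigma : N -> term S void) (D : N -> Prop) :
  (forall b, D b -> exists2 r, (b, r) \in prods G /\ sigma b = subst sigma r
      & forall b', occurs b' r -> D b' /\ h b' < h b) ->
  D (start G) -> language G (sigma (start G)).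
Proof.
move=> prodD Dstart; pose io := fun x : void => Var (of_void N x) : term S N.
(* Outer induction on a rank bound, inner induction on the term: expanding a non-terminal lowers the
   bound but may enlarge the term. *)
have ground m t : (forall b, occurs b t -> D b /\ h b < m) ->
    steps sigma t (subst io (subst sigma t)).
  elim: m t => [|m IHm] t.
    elim: t => [b /(_ b (eqxx b))[]|f a IH] // occD.
    apply: steps_App => i; rewrite !ffunE; apply: IH => b ob.
    by apply: occD; apply/existsP; exists i.
  elim: t => [b /(_ b (eqxx b))[Db ltb]|f a IH occD].
    have [r [pr eqr] occr] := prodD b Db.
    apply: (Relation_Operators.rt1n_trans _ _ _ r); first by split; [apply: step_root|].
    rewrite /= eqr; apply: IHm => b' /occr[Db' ltb']; split=> //.
    exact: leq_trans ltb' _.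
  apply: steps_App => i; rewrite !ffunE; apply: IH => b ob.
  by apply: occD; apply/existsP; exists i.
have : steps sigma (Var (start G)) (subst io (sigma (start G))).
  apply: (ground (h (start G)).+1) => b /eqP ->; split=> //.
have chain t t' : steps sigma t t' -> exists n d, [/\ d n = t', d 0 = t
    & forall i, i < n -> step (d i) (d i.+1) /\ subst sigma (d i) = subst sigma (d i.+1)].
  elim=> {t t'} [t|t t' t'' st _ [n [d [dn d0 dP]]]]; first by exists 0, (fun=> t).
  exists n.+1, (fun i => if i is i'.+1 then d i' else t).
  by split=> // -[_|i /dP] //=; rewrite d0.
case/chain=> n [d [dn d0 dP]].
have dsub i : i <= n -> subst sigma (d i) = sigma (start G).
  elim: i => [|i IH] lei; first by rewrite d0.
  by rewrite -(dP i lei).2 IH // ltnW.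
exists n, d; split=> //; first by split=> [|i /dP[]].
have at_n b i w : i <= n -> subterm_at (d i) w = Some (Var b) ->
    subterm_at (d n) w = Some (subst io (sigma b)).
  move=> lei /(subterm_at_subst sigma); rewrite dsub // => /(subterm_at_subst io).
  by rewrite -dn.
by move=> b i j w w' lei lej /(at_n _ _ _ lei) -> /(at_n _ _ _ lej) ->.
Qed.
End Grammar.

(** * Passing between the alphabet and its extension by tuple symbols *)

Section ExtendedAlphabet.
Variables (S P : alphabet) (c : S) (hc : arity c = 0) (E : prenex_sequent S P).
Notation S' := (ext_alphabet E).

Lemma embed_subst (V W : Type) (sigma : V -> term S W) t :
  embed E (subst sigma t) = subst (fun x => embed E (sigma x)) (embed E t).
Proof. by elim: t => //= f a IH; congr App; apply/ffunP=> i; rewrite !ffunE. Qed.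

Lemma occurs_embed (V : eqType) (x : V) (t : term S V) :
  occurs x (embed E t) = occurs x t.
Proof. by elim: t => //= f a IH; apply: eq_existsb => i; rewrite ffunE. Qed.

(* Needed because productions may use the symbols f_i inside terms. *)
Fixpoint erase (V : Type) (t : term S' V) : term S V :=
  match t with
  | Var x => Var x
  | App g a =>
      match g return {ffun 'I_(arity (g : S')) -> term S V} -> term S V with
      | inl f => fun b => App f b
      | inr _ => fun=> const_term hc V
      end [ffun i => erase (a i)]
  end.

Lemma embedK (V : Type) : cancel (@embed S P E V) (@erase V).
Proof. by elim=> //= f a IH; congr App; apply/ffunP=> i; rewrite !ffunE. Qed.

Lemma erase_subst (V W : Type) (sigma : V -> term S' W) t :
  erase (subst sigma t) = subst (fun x => erase (sigma x)) (erase t).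
Proof.
elim: t => // -[f|i] a IH /=; last exact/esym/subst_const.
by congr App; apply/ffunP=> i; rewrite !ffunE.
Qed.

Lemma occurs_erase (V : eqType) (x : V) (t : term S' V) :
  occurs x (erase t) -> occurs x t.
Proof.
elim: t => // -[f|i] a IH; last by rewrite [erase _]/(const_term hc V) occurs_const.
by case/existsP=> i; rewrite ffunE => /IH ox; apply/existsP; exists i.
Qed.

Lemma eval_inst (V : Type) (v : valuation S' P V) i
    (t : {ffun 'I_(nb_vars E i) -> term S' V}) :
  eval v (inst t) = eval (pull (fun s => subst t (embed E s)) v) (matrix_of E i).
Proof.
rewrite /inst /fsubst !eval_map_terms; apply: eq_eval => R a.
by congr v; apply/ffunP=> k; rewrite !ffunE.
Qed.

(** * From a Herbrand-sequent to a grammar *)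

Section FromHerbrand.
Variables (H : herbrand_data E) (l : nat).
Hypotheses (exH : extended_herbrand H) (sizeH : herbrand_size H = l).
Notation n := (n_of H).

(* The non-terminals inr j only serve to pad the grammar to l productions. *)
Definition hnonterm : finType := (option 'I_n + 'I_l)%type.
Definition hstart : hnonterm := inl None.

(* Variables that are not some alpha_i with k_i > 0 have no production: they
   are replaced by the constant, for terms containing them to stay in the
   language. *)
Definition alpha_index (x : nat) : option 'I_n :=
  [pick i | (alpha i == x) && (0 < k_of i)].

Definition hvar (x : nat) : term S hnonterm :=
  if alpha_index x is Some i then Var (inl (Some i)) else const_term hc _.

Definition assign (sigma : 'I_n -> term S void) (x : nat) : term S void :=
  if alpha_index x is Some i then sigma i else const_term hc _.

Lemma alpha_indexP x i : alpha_index x = Some i -> x = alpha i /\ 0 < k_of i.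
Proof. by rewrite /alpha_index; case: pickP => // j /andP[/eqP <- kj] [<-]. Qed.

Lemma alpha_index_alpha (i : 'I_n) : 0 < k_of i -> alpha_index (alpha i) = Some i.
Proof.
case: exH => injH _ _ _ ki; rewrite /alpha_index.
by case: pickP => [j /andP[/eqP/injH -> _]|/(_ i)] //; rewrite eqxx ki.
Qed.

Definition hstart_term i (j : 'I_(m_of H i)) : term S' hnonterm :=
  tuple_term [ffun z => embed E (subst hvar (u_of j z))].

(** Different indices may yield the same production, whereas a grammar lists each only once. After
    [undup] at most [l] remain, and padding makes up the difference. *)
Definition hprods_base : seq (hnonterm * term S' hnonterm) :=
  undup ([seq (hstart, @hstart_term i j) | i <- enum 'I_(nb_form E), j <- enum 'I_(m_of H i)]
    ++ [seq (inl (Some i), embed E (subst hvar (@s_of _ _ _ H i j)))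
         | i <- enum 'I_n, j <- enum 'I_(k_of i)]).

Definition hprods_pad : seq (hnonterm * term S' hnonterm) :=
  [seq (inr j, embed E (const_term hc _)) | j <- take (l - size hprods_base) (enum 'I_l)].

Lemma hprods_uniq : uniq (hprods_base ++ hprods_pad).
Proof.
rewrite cat_uniq undup_uniq map_inj_uniq ?take_uniq ?enum_uniq ?andbT //=; last first.
  by move=> i j [].
apply/hasPn=> p /mapP[j _ ->]; rewrite mem_undup mem_cat negb_or.
by apply/andP; split; apply/allpairsPdep=> -[? [? []]].
Qed.

Definition hgrammar : tree_grammar S' := TreeGrammar hstart hprods_uniq.

Lemma size_hgrammar : size (prods hgrammar) = l.
Proof.
rewrite /= size_cat size_map size_takel; last by rewrite size_enum_ord leq_subr.
apply: subnKC; apply: leq_trans (size_undup _) _.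
have sizeE k (m : 'I_k -> nat) :
    sumn [seq size (enum 'I_(m i)) | i <- enum 'I_k] = \sum_(i < k) m i.
  by rewrite sumnE big_map big_enum; apply: eq_bigr => i _; rewrite size_enum_ord.
by rewrite size_cat !size_allpairs_dep !sizeE -sizeH.
Qed.

Lemma hgrammar_start i (j : 'I_(m_of H i)) : (hstart, hstart_term j) \in prods hgrammar.
Proof.
rewrite /= mem_cat mem_undup mem_cat; apply/orP; left; apply/orP; left.
by apply/allpairsPdep; exists i, j; rewrite !mem_enum.
Qed.

Lemma hgrammar_cut (i : 'I_n) (j : 'I_(k_of i)) :
  (inl (Some i), embed E (subst hvar (s_of j))) \in prods hgrammar.
Proof.
rewrite /= mem_cat mem_undup mem_cat; apply/orP; left; apply/orP; right.
by apply/allpairsPdep; exists i, j; rewrite !mem_enum.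
Qed.

Lemma hgrammar_prods b r : (b, r) \in prods hgrammar ->
  [\/ b = hstart /\ exists i (j : 'I_(m_of H i)), r = hstart_term j,
      exists (i : 'I_n) (j : 'I_(k_of i)), b = inl (Some i) /\ r = embed E (subst hvar (s_of j))
    | (exists j, b = inr j) /\ r = embed E (const_term hc _)].
Proof.
rewrite /= mem_cat mem_undup mem_cat => /orP[/orP[]|].
- by case/allpairsPdep=> i [j [_ _ [-> ->]]]; constructor 1; split=> //; exists i, j.
- by case/allpairsPdep=> i [j [_ _ [-> ->]]]; constructor 2; exists i, j.
by case/mapP=> j _ [-> ->]; constructor 3; split=> //; exists j.
Qed.

(** Later variables rank lower, because the terms [s_of] at [i] mention only variables beyond
    [alpha i]; the start symbol lies above them all. *)
Definition hrank (b : hnonterm) : nat :=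
  match b with
  | inl None => n.+1
  | inl (Some i) => n - i
  | inr _ => 0
  end.

Lemma occurs_hvar x b : occurs b (hvar x) ->
  exists i, [/\ x = alpha i, b = inl (Some i) & 0 < k_of i].
Proof.
rewrite /hvar; case ex: (alpha_index x) => [i|]; last by rewrite occurs_const.
by have [-> ki] := alpha_indexP ex; move=> /eqP ->; exists i.
Qed.

Lemma occurs_hstart_term i (j : 'I_(m_of H i)) b : occurs b (hstart_term j) ->
  exists2 i', b = inl (Some i') & 0 < k_of i'.
Proof.
case/occurs_App=> z; rewrite ffunE occurs_embed => /occurs_subst[x _].
by case/occurs_hvar=> i' [_ -> ki']; exists i'.
Qed.

Lemma occurs_hcut (i : 'I_n) (j : 'I_(k_of i)) b :
  occurs b (embed E (subst hvar (s_of j))) ->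
  exists i', [/\ b = inl (Some i'), i < i' & 0 < k_of i'].
Proof.
case: exH => injH _ sH _; rewrite occurs_embed => /occurs_subst[x ox].
case/occurs_hvar=> i' [ex -> ki']; exists i'; split=> //.
by case: (sH _ _ _ ox) => i'' lti''; rewrite ex => /injH ->.
Qed.

Lemma hrank_lt b r x : (b, r) \in prods hgrammar -> occurs x r -> hrank x < hrank b.
Proof.
case/hgrammar_prods=> [[-> [i [j ->]]]|[i [j [-> ->]]]|[_ ->]].
- by case/occurs_hstart_term=> i' -> _ /=; rewrite ltnS leq_subr.
- by case/occurs_hcut=> i' [-> lti _] /=; rewrite ltn_sub2l.
by rewrite occurs_embed occurs_const.
Qed.

(** An instance of [substitution_language]: [sigma] extends to all non-terminals, the relevant ones
    being the start symbol and those with [0 < k_of i]. *)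
Lemma hgrammar_language (sigma : 'I_n -> term S void) i (j : 'I_(m_of H i)) :
  (forall i : 'I_n, 0 < k_of i ->
     exists j : 'I_(k_of i), sigma i = subst (assign sigma) (s_of j)) ->
  language hgrammar (tuple_term [ffun z => embed E (subst (assign sigma) (u_of j z))]).
Proof.
move=> sigmaP; pose theta (b : hnonterm) : term S' void :=
  match b with
  | inl None => tuple_term [ffun z => embed E (subst (assign sigma) (u_of j z))]
  | inl (Some i) => embed E (sigma i)
  | inr _ => embed E (const_term hc _)
  end.
have thetaE t : subst theta (embed E (subst hvar t)) = embed E (subst (assign sigma) t).
  rewrite !embed_subst subst_comp; apply: eq_in_subst => x _.
  rewrite /hvar /assign; case: (alpha_index x) => //=.
  by congr (@App S' _ _ _); apply/ffunP=> -[k ltk]; exfalso; move: ltk; rewrite /= hc.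
apply: (@substitution_language _ hgrammar hrank theta
  (fun b => b = hstart \/ exists2 i', b = inl (Some i') & 0 < k_of i')); last by left.
move=> b [->|[i' -> /sigmaP[j' ej']]].
  exists (hstart_term j); first split; first exact: hgrammar_start.
    by congr App; apply/ffunP=> z; rewrite !ffunE; apply/esym/thetaE.
  move=> b' ob; split; first by right; apply: occurs_hstart_term ob.
  exact: hrank_lt (hgrammar_start j) ob.
exists (embed E (subst hvar (s_of j'))); first split; first exact: hgrammar_cut.
  by rewrite thetaE /= ej'.
move=> b' ob; split; last exact: hrank_lt (hgrammar_cut j') ob.
by have [i'' [-> _ ki'']] := occurs_hcut ob; right; exists i''.
Qed.

(* alpha_i is sent to a term falsifying A_i whenever one of the candidates
   does; then each A_i implies all of its instances. *)
Lemma cut_assignment (v : valuation S P void) :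
  exists sigma : 'I_n -> term S void,
    (forall i : 'I_n, 0 < k_of i ->
       exists j : 'I_(k_of i), sigma i = subst (assign sigma) (s_of j)) /\
    (forall i : 'I_n, eval (pull (subst (assign sigma)) v) (cut_implication i)).
Proof.
case: (exH) => injH cutH sH _.
(* [Ev i sigma y] is the truth of A_i with alpha_i set to [y]. It ignores [sigma] at [i] and depends
   only on the values beyond, as [backward_choice] requires. *)
pose upd sigma (i : 'I_n) y x := if x == alpha i then y else assign sigma x.
pose Ev (i : 'I_n) sigma y := eval (pull (subst (upd sigma i y)) v) (@cutf _ _ _ H i).
have agree (i : 'I_n) f g : (forall j : 'I_n, i < j -> f j = g j) ->
    forall j : 'I_n, i < j -> assign f (alpha j) = assign g (alpha j).
  move=> fg j ltij; rewrite /assign; case ej: alpha_index => [j'|] //.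
  by have [/injH <- _] := alpha_indexP ej; apply: fg.
have [i f g x fg kR ki|i f|sigma sigmaP] := @backward_choice (term S void) (const_term hc _) n
  (fun i sigma x => 0 < k_of i ->
     (exists j : 'I_(k_of i), x = subst (assign sigma) (s_of j)) /\
     ((exists j : 'I_(k_of i), ~~ Ev i sigma (subst (assign sigma) (s_of j))) -> ~~ Ev i sigma x)).
- have sfg (j : 'I_(k_of i)) : subst (assign f) (s_of j) = subst (assign g) (s_of j).
    by apply: eq_in_subst => y /sH[j' ltij' ->]; apply: agree fg _ ltij'.
  have Efg y : Ev i f y = Ev i g y.
    apply: eq_in_eval => t ot; apply: eq_in_subst => z /ot/cutH[j' leij' ->].
    rewrite /upd; case: eqP => // nej; apply: (agree _ _ _ fg).
    by rewrite ltn_neqAle leij' andbT; apply/eqP=> /val_inj eij; rewrite eij in nej.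
  have [[j ->] evx] := kR ki; split; first by exists j; rewrite sfg.
  by move=> [j']; rewrite -Efg -sfg => evj'; rewrite -Efg; apply: evx; exists j'.
- have [/existsP[j evj]|/existsPn nev] :=
      boolP [exists j : 'I_(k_of i), ~~ Ev i f (subst (assign f) (s_of j))].
    by exists (subst (assign f) (s_of j)) => _; split=> //; exists j.
  case: (posnP (k_of i)) => [_|ki]; first by exists (const_term hc _).
  exists (subst (assign f) (s_of (Ordinal ki))) => _; split; first by exists (Ordinal ki).
  by case=> j /(negP (nev j)).
exists sigma; split=> [i /sigmaP[]//|i].
rewrite /=; apply/implyP=> evA; rewrite eval_bigAnd; apply/forallP=> j.
have ki : 0 < k_of i by apply: leq_trans (ltn_ord j).
have [_ nEv] := sigmaP i ki.
have EvE : Ev i sigma (sigma i).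
  rewrite /Ev (_ : eval _ _ = eval (pull (subst (assign sigma)) v) (cutf i)) //.
  apply: eq_in_eval => t _; apply: eq_in_subst => x _; rewrite /upd.
  by case: eqP => // ->; rewrite /assign alpha_index_alpha.
(* A false instance would, by the choice of [sigma i], make A_i itself false. *)
apply/negPn/negP=> nev; move: EvE; apply/negP/nEv; exists j; apply: contra nev.
rewrite /Ev eval_map_terms; congr is_true; apply: eq_eval => R a; congr v.
apply/ffunP=> z; rewrite !ffunE subst_comp; apply: eq_in_subst => x _.
by rewrite /upd /single_subst; case: eqP.
Qed.

Lemma grammar_of_herbrand : exists G : tree_grammar S',
  [/\ acyclic G, start_tuples G, size (prods G) = l
    & tautology (language_ante G) (language_succ G)].
Proof.
exists hgrammar; split.
- exact: (@acyclic_of_rank _ hgrammar hrank hrank_lt).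
- move=> r /hgrammar_prods[[_ [i [j ->]]]|[i [j []]]|[[j]]] //.
  by exists i, [ffun z => embed E (subst hvar (u_of j z))].
- exact: size_hgrammar.
move=> v anteT; case: (exH) => _ _ _ taut.
have [sigma [sigmaP cutP]] := cut_assignment (pull (@embed _ _ E _) v).
(* Under [w] an atom with variables takes the value of its ground instance under [sigma]. *)
pose w := pull (subst (assign sigma)) (pull (@embed _ _ E _) v).
pose t i (j : 'I_(m_of H i)) := [ffun z => embed E (subst (assign sigma) (u_of j z))].
have instE i (j : 'I_(m_of H i)) :
    eval v (inst (t i j)) = eval w (fsubst (u_of j) (matrix_of E i)).
  rewrite eval_inst eval_map_terms; apply: eq_eval => R a; congr v.
  apply/ffunP=> z; rewrite !ffunE subst_comp !embed_subst.
  by apply: eq_in_subst => x _; rewrite ffunE.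
have [A [[i [j [lti ->]]]|[i ->]]|B [i [j [lei ->]]] evB] := taut w.
- rewrite -instE; apply: anteT; exists i, (t i j); split=> //.
  exact: hgrammar_language.
- exact: cutP.
exists (inst (t i j)); last by rewrite instE.
by exists i, (t i j); split=> //; apply: hgrammar_language.
Qed.
End FromHerbrand.
End ExtendedAlphabet.

(** * From a grammar to a Herbrand-sequent *)

Section FromGrammar.
Variables (S P : alphabet) (c : S) (hc : arity c = 0) (E : prenex_sequent S P).
Notation S' := (ext_alphabet E).

Lemma App_inj (T : alphabet) (V : eqType) (f : T)
    (a b : {ffun 'I_(arity f) -> term T V}) : App f a = App f b -> a = b.
Proof.
move=> /(congr1 (@term_encode _ _))[/eq_in_map eab].
by apply/ffunP=> i; apply/term_encode_inj/eab; rewrite mem_enum.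
Qed.

(** Sorts the start productions by tuple symbol; the count is kept exact because it enters the
    size. *)
Lemma tuple_terms_split (V : eqType) (rs : seq (term S' V)) :
  (forall r, r \in rs -> exists i (u : {ffun 'I_(nb_vars E i) -> term S' V}), r = tuple_term u) ->
  exists U : forall i, seq {ffun 'I_(nb_vars E i) -> term S' V},
    \sum_i size (U i) = size rs /\
    forall r, r \in rs -> exists i, exists2 u, u \in U i & r = tuple_term u.
Proof.
elim: rs => [|r rs IH] tupP; first by exists (fun=> [::]); rewrite big1.
have [x xrs|U [sizeU memU]] := IH; first by apply: tupP; rewrite inE xrs orbT.
have [i0 [u0 er]] := tupP r (mem_head _ _).
exists (dfwith U (u0 :: U i0)); split.
  rewrite (bigD1 i0) //= dfwith_in /= addSn -sizeU [in RHS](bigD1 i0) //=.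
  by congr (_ + _).+1; apply: eq_bigr => i ni; rewrite dfwith_out // eq_sym.
move=> x; rewrite inE => /orP[/eqP ->|/memU[i [u uU ->]]].
  by exists i0, u0; rewrite // dfwith_in mem_head.
exists i, u => //; have [ei|ni] := eqVneq i0 i; last by rewrite dfwith_out.
by case: i / ei u uU => u uU; rewrite dfwith_in inE uU orbT.
Qed.

Variables (G : tree_grammar S') (l : nat).
Hypotheses (acG : acyclic G) (sizeG : size (prods G) = l).
Notation N := (nonterm G).

Definition rhs (b : N) : seq (term S' N) := [seq p.2 | p <- prods G & p.1 == b].

Lemma mem_rhs b r : (r \in rhs b) = ((b, r) \in prods G).
Proof.
apply/mapP/idP => [[[b' r'] /=]|pr]; last by exists (b, r); rewrite // mem_filter eqxx.
by rewrite mem_filter /= => /andP[/eqP -> pr] ->.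
Qed.

(** Decreasing rank makes productions mention later entries only. Non-terminals without productions
    are left out: their empty conjunction would turn the next canonical formula into [Top] and lose
    all information. *)
Definition sorted_nonterms : seq N :=
  sort (fun b b' => rank b' <= rank b)
    [seq b <- enum N | (b != start G) && (rhs b != [::])].
Notation bs := sorted_nonterms.
Notation n := (size bs).

Lemma mem_sorted_nonterms b r : b != start G -> r \in rhs b -> b \in bs.
Proof.
move=> nb rb; rewrite mem_sort mem_filter nb mem_enum andbT /=.
by apply/eqP=> e; rewrite e in rb.
Qed.

Lemma sorted_nonterms_uniq : uniq bs.
Proof. by rewrite sort_uniq filter_uniq ?enum_uniq. Qed.

Lemma index_lt b b' : depends b b' -> b \in bs -> b' \in bs -> index b bs < index b' bs.
Proof.
move=> dbb' bb bb'; rewrite ltnNge; apply/negP=> le_ix.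
have := rank_lt acG dbb'; rewrite ltnNge => /negP; apply.
have le_tr : transitive (fun b b' : N => rank b' <= rank b).
  by move=> y x z lexy leyz; apply: leq_trans leyz lexy.
have le_refl : reflexive (fun b b' : N => rank b' <= rank b) by move=> x; apply: leqnn.
apply: (sorted_leq_index le_tr le_refl _ _ _ bb' bb le_ix).
by apply: sort_sorted => x y; apply: leq_total.
Qed.

Lemma size_prods_rhs : \sum_b size (rhs b) = size (prods G).
Proof.
rewrite -sum1_size (partition_big (fun p => p.1) predT) //=.
apply: eq_bigr => b _; rewrite size_map size_filter -sum1_count.
by rewrite big_mkcond [RHS]big_mkcond.
Qed.

Lemma sum_rhs : size (rhs (start G)) + \sum_(i < n) size (rhs (nth (start G) bs i)) = l.
Proof.
rewrite -sizeG -size_prods_rhs (bigD1 (start G)) //=; congr (_ + _).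
rewrite -(big_mkord predT (fun i => size (rhs (nth (start G) bs i)))).
rewrite -(big_nth (start G) predT (fun b => size (rhs b))).
rewrite (perm_big _ (permEl (perm_sort _ _))) big_filter /= big_enum_cond /=.
rewrite big_mkcond [RHS]big_mkcond; apply: eq_bigr => b _ /=.
by case: (b != start G) => //=; case: eqP => [->|].
Qed.

(** Filling with the constant is harmless: past the start, the derivation of a term of the language
    meets only non-terminals in [bs]. *)
Definition gvar (b : N) : term S nat :=
  if b \in bs then Var (index b bs) else const_term hc _.

Definition to_nat_vars (t : term S' N) : term S nat := subst gvar (erase hc t).

Definition gprod (i j : nat) : term S nat :=
  to_nat_vars (nth (Var (start G)) (rhs (nth (start G) bs i)) j).

Lemma occurs_gvar b x : occurs x (gvar b) -> b \in bs /\ x = index b bs.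
Proof.
rewrite /gvar; case: ifP => [bb /eqP ->|_] //.
by rewrite occurs_const.
Qed.

Lemma occurs_to_nat_vars t x : occurs x (to_nat_vars t) -> x < n.
Proof. by case/occurs_subst=> b _ /occurs_gvar[bb ->]; rewrite index_mem. Qed.

Lemma occurs_rhs (i : 'I_n) r x :
  r \in rhs (nth (start G) bs i) -> occurs x (to_nat_vars r) -> i < x < n.
Proof.
rewrite mem_rhs => pr ox; rewrite (occurs_to_nat_vars ox) andbT.
case/occurs_subst: ox => b /occurs_erase ob /occurs_gvar[bb ->].
rewrite -[X in X < _](index_uniq (start G) (ltn_ord i) sorted_nonterms_uniq).
by apply: index_lt; rewrite ?mem_nth //; apply/dependsP; exists r.
Qed.

Variable U : forall i, seq {ffun 'I_(nb_vars E i) -> term S' N}.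
Hypotheses (sizeU : \sum_i size (U i) = size (rhs (start G)))
  (memU : forall r, r \in rhs (start G) -> exists i, exists2 u, u \in U i & r = tuple_term u).

Definition uterm i (j : 'I_(size (U i))) (z : 'I_(nb_vars E i)) : term S nat :=
  to_nat_vars (tnth (in_tuple (U i)) j z).

(** The sign is chosen so that a valuation falsifies all the instances of the sequent exactly when
    every literal is true. *)
Definition literal i (j : 'I_(size (U i))) : formula S P nat :=
  let A := fsubst (uterm j) (matrix_of E i) in if i < nb_ante E then A else Neg A.

(* Indexed from 0: [canonical i] is A_(i+1). *)
Fixpoint canonical (i : nat) : formula S P nat :=
  if i is i'.+1 then
    \big[@And S P nat/Top]_(j < size (rhs (nth (start G) bs i')))
      fsubst (single_subst i' (gprod i' j)) (canonical i')
  else \big[@And S P nat/Top]_(k < nb_form E) \big[@And S P nat/Top]_(j < size (U k)) literal j.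

Definition gherbrand : herbrand_data E :=
  @HerbrandData S P E (fun i => size (U i)) uterm n (fun i => i)
    (fun i => canonical i) (fun i => size (rhs (nth (start G) bs i)))
    (fun i j => gprod i j).

(** Each stage removes the lowest variable and inserts terms in later ones only. At [i = n] no
    variable is left. *)
Lemma foccurs_canonical i x : i <= n -> foccurs x (canonical i) -> i <= x < n.
Proof.
elim: i x => [|i IH] x lei.
  rewrite foccurs_bigAnd => /existsP[k]; rewrite foccurs_bigAnd => /existsP[j].
  have -> : foccurs x (literal j) = foccurs x (fsubst (uterm j) (matrix_of E k)).
    by rewrite /literal; case: ifP.
  by case/foccurs_fsubst=> y _ /occurs_to_nat_vars.
rewrite foccurs_bigAnd => /existsP[j] /foccurs_fsubst[y].
move=> /(IH _ (ltnW lei))/andP[leiy ltyn]; rewrite /single_subst; case: eqP => [_|ney].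
  apply: (@occurs_rhs (Ordinal lei)); exact: mem_nth.
by move/eqP=> ->; rewrite ltyn andbT ltn_neqAle leiy andbT; apply/eqP=> /esym.
Qed.

Definition gassign (f : 'I_n -> term S nat) (x : nat) : term S nat :=
  if insub x is Some i then f i else Var x.

Definition closed_term (t : term S' void) : term S nat :=
  subst (fun x : void => Var (of_void nat x)) (erase hc t).

(** An equation is solved for every entry of [bs], even one that the derivation never uses, because
    the descent through the canonical formulas selects a conjunct at each stage. *)
Lemma language_assignment i (t : {ffun 'I_(nb_vars E i) -> term S' void}) :
  language G (tuple_term t) ->
  exists f : 'I_n -> term S nat,
    (forall i : 'I_n, exists j : 'I_(size (rhs (nth (start G) bs i))),
        f i = subst (gassign f) (gprod i j)) /\
    exists j : 'I_(size (U i)), forall z, subst (gassign f) (uterm j z) = closed_term (t z).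
Proof.
move=> /(language_substitution (embed E (const_term hc void)) acG).
move=> [sigma [D [[r [pr er] occr] DP]]].
have Dbs b : D b -> b \in bs.
  by case/DP=> nb [r' [pr' _] _]; apply: (@mem_sorted_nonterms _ r'); rewrite ?mem_rhs.
(* [rho] picks the production solved by [sigma] on [D], and an arbitrary one on the rest of [bs]. *)
have [rho rhoP] : exists rho : N -> term S' N, forall b,
    (b \in bs -> rho b \in rhs b) /\
    (D b -> sigma b = subst sigma (rho b) /\ forall b', occurs b' (rho b) -> D b').
  apply: (fin_all_exists (P := fun b r' => (b \in bs -> r' \in rhs b) /\
    (D b -> sigma b = subst sigma r' /\ forall b', occurs b' r' -> D b'))) => b.
  have [Db|nDb] := classic (D b).
    by have [_ [r' [pr' er'] occr']] := DP b Db; exists r'; rewrite mem_rhs.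
  have [bb|nbb] := boolP (b \in bs); last by exists r.
  have : rhs b != [::] by move: bb; rewrite mem_sort mem_filter => /andP[/andP[]].
  by case: (rhs b) => // r' s _; exists r'; rewrite mem_head.
pose rho_at (i : 'I_n) := to_nat_vars (rho (nth (start G) bs i)).
have rho_rhs (i' : 'I_n) : rho (nth (start G) bs i') \in rhs (nth (start G) bs i').
  by apply: (rhoP _).1; rewrite mem_nth.
have [i' f g x fg ->|i' f|f fP] := @backward_choice (term S nat) (const_term hc _) n
    (fun i f x => x = subst (gassign f) (rho_at i)).
- apply: eq_in_subst => y /(occurs_rhs (rho_rhs i'))/andP[lty ltyn].
  by rewrite /gassign insubT; apply: fg.
- by exists (subst (gassign f) (rho_at i')).
have transfer t' : (forall b, occurs b t' -> D b /\
       gassign f (index b bs) = closed_term (sigma b)) ->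
    subst (gassign f) (to_nat_vars t') = closed_term (subst sigma t').
  move=> occD; rewrite /closed_term erase_subst !subst_comp.
  apply: eq_in_subst => b /occurs_erase/occD[Db eb].
  by rewrite /gvar (Dbs _ Db) /= eb.
(* On [D] the equations determine the values, by induction on rank; so [f] agrees there with [sigma]
   up to erasing tuple symbols. *)
have fsigma b : D b -> gassign f (index b bs) = closed_term (sigma b).
  have [m] := ubnP (rank b); elim: m b => // m IH b ltm Db.
  have ltb : index b bs < n by rewrite index_mem Dbs.
  have [rb /(_ Db)[-> occD]] := rhoP b.
  rewrite /gassign insubT fP /rho_at /= nth_index ?Dbs //.
  apply: transfer => b' ob'; split; first exact: occD.
  apply: IH (occD _ ob'); rewrite ltnS in ltm; apply: leq_trans ltm.
  by apply: rank_lt => //; apply/dependsP; exists (rho b) => //; rewrite -mem_rhs rb ?Dbs.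
exists f; split=> [i'|].
  have /seq_tnthP[j ej] := rho_rhs i'; exists j.
  by rewrite {1}fP /rho_at /gprod ej (tnth_nth (Var (start G))).
have [i1 [u uU eu]] := memU (etrans (mem_rhs _ _) pr).
move: er; rewrite eu => er; have ei : i1 = i by case: er.
case: i / ei t er => t /App_inj ->; have /seq_tnthP[j ej] := uU.
exists j => z; rewrite /uterm -ej ffunE; apply: transfer => b ob.
have Db : D b by apply: occr; rewrite eu; apply/existsP; exists z.
by split=> //; apply: fsigma.
Qed.

Lemma gherbrand_extended :
  tautology (language_ante G) (language_succ G) -> extended_herbrand gherbrand.
Proof.
move=> taut; split.
- exact: val_inj.
- move=> i x /(foccurs_canonical (ltnW (ltn_ord i)))/andP[lei ltx].
  by exists (Ordinal ltx).
- move=> i j x ox; have /andP[ltix ltx] : i < x < n.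
    by apply: occurs_rhs ox; apply: mem_nth.
  by exists (Ordinal ltx).
move=> v anteT; apply: NNPP => no_succ.
have literalT k (j : 'I_(size (U k))) : eval v (literal j).
  rewrite /literal; case: ltnP => lek.
    by apply: anteT; left; exists k, j.
  by apply/negP=> evk; apply: no_succ; exists (fsubst (uterm j) (matrix_of E k)) => //; exists k, j.
have canonicalT i : i <= n -> eval v (canonical i).
  elim: i => [|i IH] lei.
    rewrite eval_bigAnd; apply/forallP=> k; rewrite eval_bigAnd; apply/forallP=> j.
    exact: literalT.
  have : eval v (@cut_implication S P E gherbrand (Ordinal lei)).
    by apply: anteT; right; exists (Ordinal lei).
  by move/implyP; apply; apply/IH/ltnW.
(* Each instance from the language gets the value that falsifies its sequent: true on the left,
   false on the right. *)
have key k (t : {ffun 'I_(nb_vars E k) -> term S' void}) :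
    language G (tuple_term t) -> eval (pull closed_term v) (inst t) = (k < nb_ante E).
  move=> /language_assignment[f [fP [j tE]]].
  pose w := pull (subst (gassign f)) v.
  (* Descent from the variable-free [canonical n] to [canonical 0]: under [w], the conjunct of the
     production selected by [f] has the value of the formula one stage below. *)
  have canon0 i : i <= n -> eval w (canonical (n - i)).
    elim: i => [|i IH] lei.
      rewrite subn0 (_ : eval w _ = eval v (canonical n)); first exact: canonicalT.
      transitivity (eval (pull id v) (canonical n)).
        apply: eq_in_eval => t' ot'; apply: subst_id => x /ot'.
        by move/(foccurs_canonical (leqnn _))/andP=> [lex ltx]; rewrite ltnNge lex in ltx.
      by apply: eq_eval => R a; congr v; apply/ffunP=> z; rewrite ffunE.
    have := IH (ltnW lei); have lti : n - i.+1 < n by rewrite -subn_gt0 subKn.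
    rewrite -subSS subSn // eval_bigAnd; have [j' ej'] := fP (Ordinal lti).
    move/forallP/(_ j'); rewrite eval_map_terms; congr is_true.
    apply: eq_eval => R a; congr v; apply/ffunP=> z; rewrite !ffunE subst_comp.
    apply: eq_in_subst => x _; rewrite /single_subst; case: eqP => //= ->.
    by rewrite -ej' /gassign insubT.
  have := canon0 n (leqnn n); rewrite subnn eval_bigAnd => /forallP/(_ k).
  rewrite eval_bigAnd => /forallP/(_ j).
  have -> : eval (pull closed_term v) (inst t) = eval w (fsubst (uterm j) (matrix_of E k)).
    rewrite eval_inst eval_map_terms; apply: eq_eval => R a; congr v.
    apply/ffunP=> z; rewrite !ffunE /closed_term erase_subst embedK !subst_comp.
    by apply: eq_in_subst => x _; rewrite tE.
  by rewrite /literal; case: ifP => _ //= /negPf.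
have [A [k [t [ltk langt ->]]]|B [k [t [lek langt ->]]]] := taut (pull closed_term v).
  by rewrite key.
by rewrite key // ltnNge lek.
Qed.

Lemma size_gherbrand : herbrand_size gherbrand = l.
Proof. by rewrite /herbrand_size /= sizeU sum_rhs. Qed.
End FromGrammar.

Theorem theorem9 (S P : alphabet) (c : S) (hc : arity c = 0)
    (E : prenex_sequent S P) (l : nat) :
  (exists H : herbrand_data E, extended_herbrand H /\ herbrand_size H = l) <->
  (exists G : tree_grammar (ext_alphabet E),
     [/\ acyclic G, start_tuples G, size (prods G) = l
       & tautology (language_ante G) (language_succ G)]).
Proof.
split=> [[H [exH sizeH]]|[G [acG startG sizeG taut]]].
  exact: (grammar_of_herbrand hc exH sizeH).
have [r|U [sizeU memU]] := @tuple_terms_split _ _ E _ (rhs (start G)).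
  by rewrite mem_rhs => /startG.
exists (gherbrand hc U); split; first exact: gherbrand_extended.
exact: size_gherbrand.
Qed.
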